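(* If $X_n \in MS$ for each $n \in \omega$, then the Tychonov product $\prod_{n\in\omega} X_n$ is in $MS$.
   Context: All spaces are Hausdorff. $MS$ is the class of compact Hausdorff spaces $X$ such that every Radon measure (finite regular Borel measure) on $X$ is separable, where a measure is separable iff its measure algebra (Borel sets modulo null sets, with metric $d(A,B)=\mu(A\triangle B)$) is separable as a metric space. *)

(* Defs.v *)
From HB Require Import structures.
From mathcomp Require Import all_boot all_order all_algebra generic_quotient.
From mathcomp Require Import all_classical all_reals all_analysis.
Set Implicit Arguments.
Unset Strict Implicit.
Unset Printing Implicit Defensive.
Import Order.TTheory GRing.Theory Num.Theory.
Import numFieldNormedType.Exports.
Local Open Scope classical_set_scope.
Local Open Scope ring_scope.

Definition separable_space (T : topologicalType) : Prop :=
  exists2 D : set T, countable D & dense D.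

Section measure_algebra.
Context d (T : measurableType d) (R : realType).
Variable mu : {finite_measure set T -> \bar R}.

Local Notation msets := (set_type (@measurable d T)).

Definition symdiff_dist (A B : msets) : R := fine (mu (val A `+` val B)).

Lemma msetP (A : msets) : measurable (val A).
Proof. exact: set_mem (valP A). Qed.

Lemma msetY (A B : msets) : measurable (val A `+` val B).
Proof. by apply: measurableU; apply: measurableD; exact: msetP. Qed.

Lemma symdiff_distE (A B : msets) :
  (symdiff_dist A B)%:E = mu (val A `+` val B).
Proof. by rewrite /symdiff_dist fineK// fin_num_measure//; exact: msetY. Qed.

Lemma symdiff_distxx A : symdiff_dist A A = 0.
Proof. by rewrite /symdiff_dist setYK measure0. Qed.

Lemma symdiff_distC A B : symdiff_dist A B = symdiff_dist B A.
Proof. by rewrite /symdiff_dist setYC. Qed.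

Lemma symdiff_dist_ge0 A B : 0 <= symdiff_dist A B.
Proof. exact: fine_ge0. Qed.

Lemma symdiff_dist_triangle B A C :
  symdiff_dist A C <= symdiff_dist A B + symdiff_dist B C.
Proof.
rewrite -lee_fin EFinD !symdiff_distE.
apply: (@le_trans _ _ (mu ((val A `+` val B) `|` (val B `+` val C)))); last first.
  by apply: measureU2; exact: msetY.
apply: le_measure; rewrite ?inE; first exact: msetY.
  by apply: measurableU; exact: msetY.
by move=> x; rewrite /setY /=; have [Bx|nBx] := pselect (val B x); tauto.
Qed.

Definition null_diff (A B : msets) : bool := symdiff_dist A B == 0.

Lemma null_diff_refl : reflexive null_diff.
Proof. by move=> A; rewrite /null_diff symdiff_distxx. Qed.

Lemma null_diff_sym : symmetric null_diff.
Proof. by move=> A B; rewrite /null_diff symdiff_distC. Qed.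

Lemma null_diff_trans : transitive null_diff.
Proof.
move=> B A C /eqP AB /eqP BC; rewrite /null_diff eq_le symdiff_dist_ge0 andbT.
by rewrite (le_trans (symdiff_dist_triangle B A C))// AB BC addr0.
Qed.

Canonical null_diff_equiv :=
  EquivRel null_diff null_diff_refl null_diff_sym null_diff_trans.

Local Open Scope quotient_scope.

Definition measure_algebra : Type := {eq_quot null_diff}.
HB.instance Definition _ := Choice.on measure_algebra.
HB.instance Definition _ := EqQuotient.on measure_algebra.

Definition measure_algebra_dist (a b : measure_algebra) : R :=
  symdiff_dist (repr a) (repr b).

Lemma measure_algebra_distxx a : measure_algebra_dist a a = 0.
Proof. exact: symdiff_distxx. Qed.

Lemma measure_algebra_dist_eq0 a b : measure_algebra_dist a b = 0 -> a = b.
Proof.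
move=> ab0; rewrite -[a]reprK -[b]reprK; apply/eqP; rewrite eqmodE.
exact/eqP.
Qed.

Lemma measure_algebra_distC a b :
  measure_algebra_dist a b = measure_algebra_dist b a.
Proof. exact: symdiff_distC. Qed.

Lemma measure_algebra_dist_triangle b a c :
  measure_algebra_dist a c <= measure_algebra_dist a b + measure_algebra_dist b c.
Proof. exact: symdiff_dist_triangle. Qed.

HB.instance Definition _ := @isMetric.Build R measure_algebra
  measure_algebra_dist measure_algebra_distxx measure_algebra_dist_eq0
  measure_algebra_distC measure_algebra_dist_triangle.

(* The distance does not depend on the representatives chosen by [repr]. *)
Lemma mdist_pi (A B : msets) :
  mdist (\pi_measure_algebra A) (\pi_measure_algebra B) =
  fine (mu (val A `+` val B)).
Proof.
have rE (C : msets) : symdiff_dist (repr (\pi_measure_algebra C)) C = 0.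
  have : repr (\pi_measure_algebra C) == C %[mod measure_algebra].
    by rewrite reprK.
  by rewrite eqmodE => /eqP.
set A' := repr (\pi_measure_algebra A); set B' := repr (\pi_measure_algebra B).
change (symdiff_dist A' B' = symdiff_dist A B).
have A'A : symdiff_dist A' A = 0 by exact: rE.
have B'B : symdiff_dist B' B = 0 by exact: rE.
apply/eqP; rewrite eq_le; apply/andP; split.
  rewrite (le_trans (symdiff_dist_triangle A _ _))// A'A add0r.
  by rewrite (le_trans (symdiff_dist_triangle B _ _))// (symdiff_distC B) B'B addr0.
rewrite (le_trans (symdiff_dist_triangle A' _ _))// (symdiff_distC A) A'A add0r.
by rewrite (le_trans (symdiff_dist_triangle B' _ _))// B'B addr0.
Qed.

Definition separable_measure : Prop := separable_space measure_algebra.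

End measure_algebra.

Notation borelType T := (g_sigma_algebraType (@open T)).

(* Both halves of regularity are required. On a compact Hausdorff space, the
   only case used below, the compact sets in the inner half are exactly the
   closed ones. *)
Definition regular_measure (R : realType) (T : ptopologicalType)
    (mu : {finite_measure set (borelType T) -> \bar R}) : Prop :=
  forall A : set (borelType T), measurable A ->
    mu A = ereal_inf [set mu U | U in [set U : set T | open U /\ A `<=` U]] /\
    mu A = ereal_sup [set mu K | K in [set K : set T | compact K /\ K `<=` A]].

(* [measurableType] requires a distinguished point, a topological space does
   not have one: [pointed_at x0] is the space [T] itself, pointed at [x0]. *)
Definition pointed_at (T : topologicalType) (x0 : T) : Type := T.

HB.instance Definition _ (T : topologicalType) (x0 : T) :=
  Topological.on (pointed_at x0).
HB.instance Definition _ (T : topologicalType) (x0 : T) :=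
  isPointed.Build (pointed_at x0) x0.

(* The base point [x0] only serves to form the Borel measurable space: neither
   regularity nor separability depends on it. If [T] is empty, its only measure
   is 0, which is separable, so that the vacuous quantification is right. *)
Definition MS (R : realType) (T : topologicalType) : Prop :=
  [/\ hausdorff_space T, compact [set: T] &
      forall (x0 : T) (mu : {finite_measure set (borelType (pointed_at x0)) -> \bar R}),
        regular_measure mu -> separable_measure mu].

(* Main.v *)
(** Let mu be a Radon measure on the product. Each coordinate image of mu is
again Radon, hence its measure algebra has a dense sequence E_(n,k). The
preimages of the E_(n,k) under the projections generate, by finite unions and
intersections, a countable family G. The Borel sets approximable by G in
measure are closed under finite unions and intersections and contain the
preimages of open sets of the factors, so they contain a basis of open sets.
Given a Borel set A, regularity provides K compact and V open around A with
mu (V \ K) small, and compactness provides an approximable open set between K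
and V. Only the marginals of mu intervene: mu need not be a product. *)

From HB Require Import structures.
Require Import Defs.
From mathcomp Require Import all_boot all_order all_algebra.
From mathcomp Require Import generic_quotient lra finmap.
From mathcomp Require Import all_classical all_reals all_analysis.
Set Implicit Arguments.
Unset Strict Implicit.
Unset Printing Implicit Defensive.
Import Order.TTheory GRing.Theory Num.Theory.
Import numFieldNormedType.Exports.
Local Open Scope classical_set_scope.
Local Open Scope ring_scope.
Local Open Scope ereal_scope.

(** * Approximation in measure by a family of sets *)

Section approximable.
Context d (T : measurableType d) (R : realType).
Variable mu : {finite_measure set T -> \bar R}.

Definition approximable (I : Type) (G : I -> set T) (A : set T) :=
  forall e : R, (0 < e)%R -> exists i, mu (A `+` G i) < e%:E.

Lemma measure_ltD (A : set T) (e : R) : measurable A -> (0 < e)%R ->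
  mu A < mu A + e%:E.
Proof. by move=> mA e0; rewrite lteDl// ?lte_fin// fin_num_measure. Qed.

Lemma measurableY (A B : set T) :
  measurable A -> measurable B -> measurable (A `+` B).
Proof. by move=> mA mB; apply: measurableU; exact: measurableD. Qed.

Lemma measureY_triangle (B A C : set T) :
  measurable A -> measurable B -> measurable C ->
  mu (A `+` C) <= mu (A `+` B) + mu (B `+` C).
Proof.
move=> mA mB mC; apply: (@le_trans _ _ (mu ((A `+` B) `|` (B `+` C)))).
  apply: le_measure; rewrite ?inE; first exact: measurableY.
    by apply: measurableU; exact: measurableY.
  by move=> x; rewrite /setY /=; have [Bx|nBx] := pselect (B x); tauto.
by apply: measureU2; exact: measurableY.
Qed.

Lemma approximable_trans (I : Type) (G : I -> set T) (A : set T) :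
    (forall i, measurable (G i)) -> measurable A ->
    (forall e : R, (0 < e)%R ->
      exists B, [/\ measurable B, approximable G B & mu (A `+` B) < e%:E]) ->
  approximable G A.
Proof.
move=> mG mA AB e e0; have e20 : (0 < e / 2)%R by rewrite divr_gt0.
have [B [mB /(_ _ e20)[i Bi] AeB]] := AB _ e20.
exists i; apply: le_lt_trans (measureY_triangle mA mB (mG i)) _.
by rewrite (splitr e) EFinD lteD.
Qed.

Section lattice.
Variables (I : Type) (G : I -> set T) (op : set T -> set T -> set T).
Hypothesis mG : forall i, measurable (G i).
Hypothesis mop : forall A B,
  measurable A -> measurable B -> measurable (op A B).
Hypothesis Gop : forall i j, exists k, G k = op (G i) (G j).
Hypothesis opY : forall A B A' B',
  op A B `+` op A' B' `<=` (A `+` A') `|` (B `+` B').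

(** [opY] bounds the error of [op] by the sum of the errors of its arguments, so two approximations
    within [e / 2] give one within [e]. Union and intersection are the intended instances. *)
Lemma approximable_op (A B : set T) : measurable A -> measurable B ->
  approximable G A -> approximable G B -> approximable G (op A B).
Proof.
move=> mA mB aA aB e e0; have e20 : (0 < e / 2)%R by rewrite divr_gt0.
have [i Ai] := aA _ e20; have [j Bj] := aB _ e20; have [k Gk] := Gop i j.
exists k; rewrite Gk.
apply: (@le_lt_trans _ _ (mu ((A `+` G i) `|` (B `+` G j)))).
  apply: le_measure; rewrite ?inE//.
    by apply: measurableY; exact: mop.
  by apply: measurableU; exact: measurableY.
apply: le_lt_trans (measureU2 _ _ _) _; [exact: measurableY..|].
by rewrite (splitr e) EFinD lteD.
Qed.

End lattice.

Lemma ball_measure_algebra (A B : set_type (@measurable d T)) (e : R) :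
  ball (\pi_(measure_algebra mu)%qT A) e (\pi_(measure_algebra mu)%qT B) <->
  mu (val A `+` val B) < e%:E.
Proof. by rewrite ballEmdist /= mdist_pi -lte_fin symdiff_distE. Qed.

(** With [approximable_separable_measure], this moves separability from classes modulo null sets to
    actual sets, on which preimages and lattice operations act directly. *)
Lemma separable_measure_approximable : separable_measure mu ->
  exists G : nat -> set T, (forall k, measurable (G k)) /\
    forall A, measurable A -> approximable G A.
Proof.
move=> [D cD dD].
have /pfcard_geP[D0|[g]] := cD.
  (* An empty [D] is not dense, since the algebra contains the class of [set0]. *)
  have [|x []] := dD setT _ openT; last by rewrite D0.
  by exists (\pi_(measure_algebra mu)%qT (SigSub (mem_set measurable0))).
exists (fun k => val (repr (g k))); split=> [k|A mA e e0]; first exact: msetP.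
pose a : measure_algebra mu :=
  \pi_(measure_algebra mu)%qT (SigSub (mem_set mA)).
have [||y [/interior_subset aey Dy]] := dD (ball a e)°.
- by exists a; exact: nbhsx_ballx.
- exact: open_interior.
have [k _ gk] := @surj _ _ _ _ g _ Dy.
exists k; apply/(ball_measure_algebra (SigSub (mem_set mA))).
by rewrite reprK gk.
Qed.

Lemma approximable_separable_measure (I : countType) (G : I -> set T) :
    (forall i, measurable (G i)) ->
    (forall A, measurable A -> approximable G A) ->
  separable_measure mu.
Proof.
move=> mG aG.
pose g i : measure_algebra mu :=
  \pi_(measure_algebra mu)%qT (SigSub (mem_set (mG i))).
exists (range g).
  by apply: card_le_trans (card_image_le _ _) _; exact: countableP.
move=> O [a Oa] oO.
have /nbhs_ballP[e /= e0 aeO] : nbhs a O by exact: open_nbhs_nbhs.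
have [i ai] := aG _ (msetP (repr a)) _ e0.
exists (g i); split; last by exists i.
by apply: aeO; rewrite -[a]reprK; apply/ball_measure_algebra.
Qed.

End approximable.

(** * Lattice generated by a family of sets *)

Section finite_lattice_terms.
Context (T J : Type) (E : J -> set T).

(** Disjunctive normal form: the index type [seq (seq J)] is countable as soon as [J] is. The list
    [[::]] yields [set0] and [[:: [::]]] yields [setT]. *)
Definition lattice_term (s : seq (seq J)) : set T :=
  \big[setU/set0]_(l <- s) \big[setI/setT]_(j <- l) E j.

Lemma lattice_termU s t :
  lattice_term (s ++ t) = lattice_term s `|` lattice_term t.
Proof. by rewrite /lattice_term big_cat. Qed.

(** Distributivity restores the normal form, with one concatenated list per pair of lists. *)
Lemma lattice_termI s t :
  lattice_term [seq l ++ m | l <- s, m <- t] =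
  lattice_term s `&` lattice_term t.
Proof.
rewrite /lattice_term big_allpairs_dep big_distrlr/=.
by apply: eq_bigr => l _; apply: eq_bigr => m _; rewrite big_cat.
Qed.

Lemma lattice_term1 j : lattice_term [:: [:: j]] = E j.
Proof. by rewrite /lattice_term !big_seq1. Qed.

End finite_lattice_terms.

Lemma measurable_lattice_term d (T : measurableType d) (J : Type)
    (E : J -> set T) (s : seq (seq J)) :
  (forall j, measurable (E j)) -> measurable (lattice_term E s).
Proof.
move=> mE; apply: bigsetU_measurable => l _.
by apply: big_ind => //; exact: measurableI.
Qed.

(** * Regularity on Hausdorff spaces *)

Section regular.
Context (R : realType) (T : ptopologicalType).
Variable mu : {finite_measure set (borelType T) -> \bar R}.

Lemma open_borel (A : set T) : open A -> measurable (A : set (borelType T)).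
Proof. exact: sub_sigma_algebra. Qed.

Lemma closed_borel (A : set T) : closed A -> measurable (A : set (borelType T)).
Proof.
move=> cA; rewrite -[A]setCK; apply: measurableC; apply: open_borel.
exact: closed_openC.
Qed.

Hypothesis hT : hausdorff_space T.

Lemma compact_borel (A : set T) :
  compact A -> measurable (A : set (borelType T)).
Proof. by move=> cA; apply: closed_borel; exact: compact_closed. Qed.

(** Outer regularity follows by complements: a compact set filling the complement of [A] up to [e]
    is closed, and its own complement is an open set around [A] of measure below [mu A + e]. *)
Lemma inner_regular_measure :
    (forall (A : set (borelType T)) (e : R), measurable A -> (0 < e)%R ->
      exists K : set T, [/\ compact K, K `<=` A & mu A < mu K + e%:E]) ->
  regular_measure mu.
Proof.
move=> inner A mA; split; apply/eqP; rewrite eq_le; apply/andP; split.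
- apply: le_ereal_inf_tmp => _ [U [oU AU] <-].
  by apply: le_measure => //; rewrite inE//; exact: open_borel.
- apply/lee_addgt0Pr => e e0.
  have [K [cK KA AK]] := inner _ _ (measurableC mA) e0.
  have mK := compact_borel cK.
  apply: ge_ereal_inf; exists (mu (~` K)).
    exists (~` K) => //; split; last by move=> x Ax Kx; exact: KA Ax.
    by apply: closed_openC; exact: compact_closed.
  have muT B : measurable B -> mu setT = mu B + mu (~` B).
    by move=> mB; rewrite -measureU ?setUv ?setICr//; exact: measurableC.
  (* The total mass, split along [K] and along [A], turns the bound on the complement of [A] into
     one on the complement of [K]; all terms are finite. *)
  have := muT _ mK; rewrite (muT _ mA).
  move: AK; have fin := @fin_num_measure _ _ _ mu.
  rewrite -(fineK (fin _ mA)) -(fineK (fin _ mK)).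
  rewrite -(fineK (fin _ (measurableC mA))) -(fineK (fin _ (measurableC mK))).
  by rewrite -!EFinD lte_fin lee_fin => AK [AKE]; lra.
- apply/lee_addgt0Pr => e e0.
  have [K [cK KA AK]] := inner _ _ mA e0.
  apply: (le_trans (ltW AK)); rewrite leeD2r//.
  by apply: ereal_sup_ubound; exists K.
- apply: ge_ereal_sup => _ [K [cK KA] <-].
  by apply: le_measure => //; rewrite inE//; exact: compact_borel.
Qed.

Lemma regular_measure_approx (A : set (borelType T)) (e : R) :
    regular_measure mu -> measurable A -> (0 < e)%R ->
  exists K U : set T,
    [/\ compact K, open U, K `<=` A, A `<=` U & mu (U `\` K) < e%:E].
Proof.
move=> rmu mA e0; have e20 : (0 < e / 2)%R by rewrite divr_gt0.
have [infA supA] := rmu _ mA; have fA := @fin_num_measure _ _ _ mu _ mA.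
have ltAe := measure_ltD mu mA e20.
have := ltAe; rewrite {1}infA => /ereal_inf_lt[_ [U [oU AU] <-] AeU].
have := ltAe; rewrite -lteBlDr// {2}supA => /ereal_sup_gt[_ [K [cK KA] <-] AeK].
exists K, U; split => //.
have mU := open_borel oU; have mK := compact_borel cK.
have -> : mu (U `\` K) = mu U - mu K.
  rewrite [LHS]measureD// ?ltey_eq ?fin_num_measure//.
  by rewrite (setIidr (subset_trans KA AU)).
move: AeU AeK; have fin := @fin_num_measure _ _ _ mu.
rewrite -(fineK fA) -(fineK (fin _ mK)) -(fineK (fin _ mU)).
by rewrite -EFinB -!EFinD !lte_fin => ? ?; lra.
Qed.

End regular.

(** * Image measures and their regularity *)

Section image_measure.
Context d1 d2 (T : measurableType d1) (U : measurableType d2) (R : realType).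
Variables (mu : {finite_measure set T -> \bar R}) (f : T -> U).
Hypothesis mf : measurable_fun setT f.

(* [pushforward mu f] is a measure only under [mf]; carrying the proof as an
   argument lets it be found by canonical structure inference. *)
Definition image_measure of measurable_fun setT f : set U -> \bar R :=
  pushforward mu f.

Local Notation im := (image_measure mf).

Lemma measurable_preimage A : measurable A -> measurable (f @^-1` A).
Proof. by move=> mA; rewrite -[X in measurable X]setTI; exact: mf. Qed.

Let im0 : im set0 = 0.
Proof. by rewrite /im /pushforward preimage_set0 measure0. Qed.

Let im_ge0 A : 0 <= im A.
Proof. exact: measure_ge0. Qed.

Let im_sigma_additive : semi_sigma_additive im.
Proof. exact: (@measure_semi_sigma_additive _ _ _ (pushforward mu f)). Qed.

HB.instance Definition _ := isMeasure.Build _ _ _ im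
  im0 im_ge0 im_sigma_additive.

Let im_fin : fin_num_fun im.
Proof. by move=> A mA; apply: fin_num_measure; exact: measurable_preimage. Qed.

HB.instance Definition _ := Measure_isFinite.Build _ _ _ im im_fin.

End image_measure.

Section continuous_image.
Context (R : realType) (T U : ptopologicalType).
Variable mu : {finite_measure set (borelType T) -> \bar R}.
Variable f : T -> U.
Hypothesis cf : continuous f.

Lemma continuous_borel :
  measurable_fun setT (f : borelType T -> borelType U).
Proof.
apply: (@measurability _ _ (borelType T) (borelType U) setT f (@open U)) => //.
move=> _ [B oB <-]; rewrite setTI; apply: open_borel.
by apply: open_comp => // x _; exact: cf.
Qed.

(** By [inner_regular_measure] only compact sets from inside are needed: a compact [K] in the
    preimage of [A] has a compact image in [A], whose measure is at least [mu K]. *)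
Lemma regular_image_measure : hausdorff_space T -> hausdorff_space U ->
  regular_measure mu -> regular_measure (image_measure mu continuous_borel).
Proof.
move=> hT hU rmu; apply: inner_regular_measure => // A e mA e0.
have mfA := measurable_preimage continuous_borel mA.
have [_ supA] := rmu _ mfA.
have := measure_ltD mu mfA e0; rewrite -lteBlDr// {2}supA.
move=> /ereal_sup_gt[_ [K [cK KfA] <-] AeK].
have cfK : compact (f @` K).
  by apply: continuous_compact => //; exact: continuous_subspaceT.
exists (f @` K); split => //; first by move=> _ [x Kx <-]; exact: KfA.
rewrite /image_measure /pushforward -lteBlDr//; apply: lt_le_trans AeK _.
apply: le_measure; rewrite ?inE.
- exact: compact_borel.
- by apply: measurable_preimage; [exact: continuous_borel|exact: compact_borel].
- exact: preimage_image.
Qed.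

End continuous_image.

(** * Separability from countably many coordinates *)

Section initial.
Context (R : realType) (T : ptopologicalType) (I : countType).
Context (U : I -> ptopologicalType).
Variables (f : forall i, T -> U i).
Variable mu : {finite_measure set (borelType T) -> \bar R}.
Hypothesis hT : hausdorff_space T.
Hypothesis cf : forall i, continuous (f i).
Hypothesis initial : forall (F : set_system T) (x : T), Filter F ->
  (forall i, f i @ F --> f i x) -> F --> x.
Hypothesis rmu : regular_measure mu.

(** The generated lattice stays countable because [I] is. The hypothesis [initial] expresses by
    filters that the maps [f i] determine the topology, as projections do on a product. *)
Lemma separable_measure_initial :
    (forall i,
      separable_measure (image_measure mu (continuous_borel (@cf i)))) ->
  separable_measure mu.
Proof.
move=> sepU.
have /boolp.choice[E EP] i : exists E : nat -> set (borelType T),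
    (forall k, measurable (E k)) /\
    forall V : set (U i), open V -> approximable mu E (f i @^-1` V).
  have [E [mE EP]] := separable_measure_approximable (sepU i).
  exists (fun k => f i @^-1` E k); split=> [k|V oV e e0].
    exact: measurable_preimage (continuous_borel (@cf i)) _ (mE k).
  (* Preimages commute with symmetric differences, so the estimate for the image measure is already
     the one for [mu]. *)
  by have [k Vk] := EP _ (open_borel oV) _ e0; exists k.
pose EJ (j : I * nat) := E j.1 j.2.
pose G := lattice_term EJ.
have mEJ j : measurable (EJ j) by exact: (EP _).1.
have mG s : measurable (G s) by exact: measurable_lattice_term.
apply: (approximable_separable_measure mG) => A mA.
(* Openness is kept beside approximability so that good sets can cover a compact set. *)
pose good : set (set T) := [set B | open B /\ approximable mu G B].
have goodU B C : good B -> good C -> good (B `|` C).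
  move=> [oB aB] [oC aC]; split; first exact: openU.
  apply: approximable_op => //; try exact: open_borel.
  - exact: measurableU.
  - by move=> s t; exists (s ++ t); exact: lattice_termU.
  - by move=> ? ? ? ? x; rewrite /setY /setU /setD /=; tauto.
have goodI B C : good B -> good C -> good (B `&` C).
  move=> [oB aB] [oC aC]; split; first exact: openI.
  apply: approximable_op => //; try exact: open_borel.
  - exact: measurableI.
  - by move=> s t; exists [seq l ++ m | l <- s, m <- t]; exact: lattice_termI.
  - move=> B' ? C' ? x; rewrite /setY /setU /setD /setI /=.
    by have [|] := pselect (B' x); have [|] := pselect (C' x); tauto.
have good0 : good set0.
  split; first exact: open0.
  by move=> e e0; exists [::]; rewrite /G /lattice_term big_nil setYK measure0.
have goodT : good setT.
  split; first exact: openT.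
  move=> e e0; exists [:: [::]].
  by rewrite /G /lattice_term big_seq1 big_nil setYK measure0.
have good_preimage i (V : set (U i)) : open V -> good (f i @^-1` V).
  move=> oV; split; first by apply: open_comp => // x _; exact: cf.
  move=> e e0; have [k Vk] := (EP i).2 _ oV _ e0.
  by exists [:: [:: (i, k)]]; rewrite /G lattice_term1.
have good_base (x : T) (V : set T) : open V -> V x ->
    exists B, [/\ good B, B x & B `<=` V].
  move=> oV Vx.
  (* The approximable open sets around [x] form a filter base converging to [x]
     coordinatewise, hence in the initial topology. *)
  pose F := filter_from [set B | good B /\ B x] id.
  have FF : Filter F.
    apply: filter_from_filter; first by exists setT.
    move=> B C [gB Bx] [gC Cx]; exists (B `&` C) => //.
    by split => //; exact: goodI.
  have Fx : F --> x.
    apply: initial => i W; rewrite nbhsE => -[V' [oV' V'x] V'W].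
    by exists (f i @^-1` V') => [|y /V'W]//; split => //; exact: good_preimage.
  have [B [gB Bx] BV] := Fx V (open_nbhs_nbhs (conj oV Vx)).
  by exists B.
apply: (approximable_trans mG mA) => e e0.
have [K [V [cK oV KA AV VK]]] := regular_measure_approx hT rmu mA e0.
(* By [good_base], good sets inside [V] cover [K]; the union of a finite subcover is good, with
   [good0] for the empty union. *)
have [B [[oB aB] KB BV]] : exists B, [/\ good B, K `<=` B & B `<=` V].
  have cover_compactK : cover_compact K by rewrite -compact_cover.
  have [|x Kx|D' D'good KD'] :=
    cover_compactK _ [set B | good B /\ B `<=` V] id.
  - by move=> B [[]].
  - have [B [gB Bx BV]] := good_base x V oV (AV _ (KA _ Kx)).
    by exists B.
  exists (\bigcup_(B in [set` D']) B); split => //; last first.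
    by move=> x [B /D'good/set_mem[_ BV] Bx]; exact: BV.
  rewrite bigcup_fset big_seq; apply: big_ind => //.
  by move=> B /D'good/set_mem[].
have mB := open_borel oB.
(* Both [A] and [B] lie between [K] and [V], so they differ only inside [V] minus [K]. *)
exists B; split => //; apply: le_lt_trans VK.
apply: le_measure; rewrite ?inE.
- exact: measurableY.
- by apply: measurableD; [exact: open_borel|exact: compact_borel].
move=> x [[Ax nBx]|[Bx nAx]]; split.
- exact: AV.
- by move=> /KB.
- exact: BV.
- by move=> /KA.
Qed.

End initial.

Theorem theorem2p3 (R : realType) (X : nat -> topologicalType)
    (hX : forall n : nat, MS R (X n)) :
  MS R (prod_topology X).
Proof.
have hP : hausdorff_space (prod_topology X).
  by apply: hausdorff_product => n; have [] := hX n.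
split=> //.
  have cX n : compact [set: X n] by have [] := hX n.
  by apply: subclosed_compact (tychonoff cX) _; [exact: closedT|].
move=> x0 mu rmu.
(* Each factor is pointed at the coordinate of [x0], so that [MS R (X n)] applies to the image
   measure. *)
pose p n : pointed_at x0 -> pointed_at (x0 n) := fun x => x n.
have cp n : continuous (p n) by exact: (@proj_continuous _ X n).
apply: (@separable_measure_initial _ _ _ _ p mu hP cp _ rmu) => [F x FF Fx|n].
  (* The product topology is the supremum of the initial topologies of the single projections, so
     convergence is tested one coordinate at a time. *)
  have supP := @cvg_sup (prod_topology X) nat (fun i => Topological.class
    (initial_topology (fun g : (forall i, X i) => g i))) F x FF.
  apply: supP.2 => n W [_ [[V oV <-] Vx] VW].
  have /Fx : nbhs (p n x) V by exact: open_nbhs_nbhs.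
  by move=> FV; apply: (@filterS _ F FF _ W VW).
have [hn _ sepn] := hX n.
by apply: (sepn (x0 n)); exact: regular_image_measure.
Qed.
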